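(* Let $p_1$ and $p_2$ be supermodular functions on the partitions of a finite set $V$ and let $\mathcal{G}=(V,\mathcal{E})$ be a hypergraph. Then $\mathcal{G}$ can be trimmed to a graph $G=(V,E)$ such that $e_E(\mathcal{P})\ge\max\{p_1(\mathcal{P}),p_2(\mathcal{P})\}$ for every partition $\mathcal{P}$ of $V$ if and only if $e_{\mathcal{E}}(\mathcal{P})\ge\max\{p_1(\mathcal{P}),p_2(\mathcal{P})\}$ for every partition $\mathcal{P}$ of $V$.
   Context: A hypergraph $(V,\mathcal{E})$ has hyperedges that are subsets of $V$ of size at least two (multiplicities allowed). Trimming a hyperedge $Z$ means replacing it by an edge whose two (distinct) end-vertices belong to $Z$; trimming a hypergraph means trimming each of its hyperedges, which yields a graph. For a set $\mathcal{F}$ of hyperedges (or edges) and a partition $\mathcal{P}$ of $V$, $e_{\mathcal{F}}(\mathcal{P})$ is the number of members of $\mathcal{F}$ not contained in a single member of $\mathcal{P}$. For partitions $\mathcal{P}_1,\mathcal{P}_2$ of $V$: start from $\mathcal{P}_1\cup\mathcal{P}_2$ (with multiplicities) and repeatedly replace two properly intersecting members $X,Y$ ($X\cap Y,X\setminus Y,Y\setminus X$ all nonempty) by $X\cap Y$ and $X\cup Y$ until no such pair remains; minimal members form $\mathcal{P}_1\sqcap\mathcal{P}_2$ (possibly depending on choices), maximal members form $\mathcal{P}_1\sqcup\mathcal{P}_2$. A function $p$ on partitions of $V$ is supermodular if $p(\mathcal{P}_1)+p(\mathcal{P}_2)\le p(\mathcal{P}_1\sqcap\mathcal{P}_2)+p(\mathcal{P}_1\sqcup\mathcal{P}_2)$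 for all partitions $\mathcal{P}_1,\mathcal{P}_2$ (and any outcome of the uncrossing).
   Formalization: The supermodular functions p_1 and p_2 are taken to be integer-valued; for real values the claim fails, e.g. V={a,b,c} with one hyperedge V and p equal to 1/2 on two-class partitions, 1 on the singletons, 0 on {V}. *)

(* Defs.v *)
From Stdlib Require Import Relation_Operators.
From mathcomp Require Import all_boot all_order all_algebra.

Set Implicit Arguments.
Unset Strict Implicit.
Unset Printing Implicit Defensive.

Import Order.TTheory GRing.Theory Num.Theory.

Local Open Scope ring_scope.

(** A multiset of (hyper)edges on [V] is a family
    [H : I -> {set V}] indexed by a finite type [I]: parallel hyperedges are
    distinct indices with the same image. *)

Definition is_hypergraph (V I : finType) (H : I -> {set V}) : Prop :=
  forall i, (2 <= #|H i|)%N.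

Definition is_graph (V I : finType) (G : I -> {set V}) : Prop :=
  forall i, #|G i| = 2%N.

(** The edge [G i] is the one by which the hyperedge [H i] is replaced. *)
Definition is_trimming (V I : finType) (H G : I -> {set V}) : Prop :=
  is_graph G /\ forall i, G i \subset H i.

Definition crossing_count (V I : finType) (H : I -> {set V})
    (P : {set {set V}}) : nat :=
  #|[set i | ~~ [exists X in P, H i \subset X]]|.

Definition properly_intersecting (V : finType) (X Y : {set V}) : bool :=
  [&& X :&: Y != set0, X :\: Y != set0 & Y :\: X != set0].

(** Multisets of subsets of [V] are sequences up to [perm_eq]. *)
Definition uncross_step (V : finType) (s t : seq {set V}) : Prop :=
  exists (X Y : {set V}) (r : seq {set V}),
    [/\ properly_intersecting X Y,
        perm_eq s [:: X, Y & r] &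
        perm_eq t [:: X :&: Y, X :|: Y & r]].

Definition uncrossed (V : finType) (t : seq {set V}) : Prop :=
  forall X Y, X \in t -> Y \in t -> ~~ properly_intersecting X Y.

(** A possible final multiset when uncrossing [P1] and [P2]; a set belonging to
    both partitions occurs twice in the initial sequence. The outcome is not
    unique in general, hence a relation. *)
Definition uncrossing_outcome (V : finType) (P1 P2 : {set {set V}})
    (t : seq {set V}) : Prop :=
  clos_refl_trans_1n _ (@uncross_step V) (enum P1 ++ enum P2) t
  /\ uncrossed t.

(** For an outcome [t] of uncrossing two partitions, every point of [V] is
    covered exactly twice, by nested members. A member of multiplicity two is
    both minimal and maximal, so it lies in both of the partitions below. *)
Definition minimal_members (V : finType) (t : seq {set V}) : {set {set V}} :=
  [set X | (X \in t) && all (fun Y : {set V} => ~~ (Y \proper X)) t].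

Definition maximal_members (V : finType) (t : seq {set V}) : {set {set V}} :=
  [set X | (X \in t) && all (fun Y : {set V} => ~~ (X \proper Y)) t].

(** [p] is only relevant on partitions of [V]; its other values are junk.
    It is integer-valued: for [V = {a,b,c}] with the single hyperedge [V], the
    function equal to 1/2 on the three two-class partitions, 1 on the singletons
    and 0 on [{V}] satisfies the inequality below, but it exceeds the crossing count of every trimming
    on some partition. *)
Definition partition_supermodular (V : finType) (p : {set {set V}} -> int)
  : Prop :=
  forall (P1 P2 : {set {set V}}) (t : seq {set V}),
    partition P1 [set: V] -> partition P2 [set: V] ->
    uncrossing_outcome P1 P2 t ->
    p P1 + p P2 <= p (minimal_members t) + p (maximal_members t).

Definition covers_on_partitions (V I : finType) (H : I -> {set V})
    (p1 p2 : {set {set V}} -> int) : Prop :=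
  forall P : {set {set V}}, partition P [set: V] ->
    Num.max (p1 P) (p2 P) <= (crossing_count H P)%:Z.

(* Main.v *)
(** Remove vertices one at a time from hyperedges of size at least three. Removing
    [v] from [Z] destroys the covering of [p] only if some tight partition [P] (one with
    [p P = e P]) is crossed by [Z] but not by [Z :\ v]. Two distinct vertices [u], [v]
    of [Z] cannot be blocked for the same [p]: uncross their tight partitions [Pu]
    and [Pv]. Every hyperedge contributes to [e Pu + e Pv] at least what it contributes to the
    meet and join, and [Z] contributes strictly more, because the classes
    containing [Z :\ u] and [Z :\ v] share a third vertex of [Z] and so are merged
    in the join. Hence each of [p1], [p2] blocks at most one of the at least three
    vertices of [Z], and some vertex can be removed. *)
Require Import Defs.
From Stdlib Require Import Relation_Operators.
From mathcomp Require Import all_boot all_order all_algebra.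
From mathcomp Require Import zify.

Set Implicit Arguments.
Unset Strict Implicit.
Unset Printing Implicit Defensive.

Import Order.TTheory GRing.Theory Num.Theory.

Lemma count_gt1_perm (T : eqType) (a : pred T) (s : seq T) :
  1 < count a s -> exists x y r, [/\ perm_eq s [:: x, y & r], a x & a y].
Proof.
have aF : all a (filter a s) by exact: filter_all.
have ps : perm_eq s (filter a s ++ filter (predC a) s).
  by rewrite perm_sym perm_filterC.
rewrite -size_filter; case: (filter a s) aF ps => [|x [|y r]] //=.
case/and3P=> ax ay _ ps _.
by exists x, y, (r ++ filter (predC a) s).
Qed.

Section Uncrossing.
Variable V : finType.
Implicit Types (X Y Z : {set V}) (s t : seq {set V}) (P : {set {set V}}).

(** * Invariants and termination of uncrossing *)

Definition crosses Z P : bool := ~~ [exists X in P, Z \subset X].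

Lemma crossesPn Z P :
  reflect (exists2 X, X \in P & Z \subset X) (~~ crosses Z P).
Proof. by rewrite negbK; apply: exists_inP. Qed.

Definition double_cover s : Prop :=
  set0 \notin s /\ forall v, count (fun X => v \in X) s = 2.

(** Each point lies in as many of [X :&: Y], [X :|: Y] as of [X], [Y], and proper intersection makes
    [X :&: Y] nonempty. *)
Lemma uncross_step_double_cover s t :
  uncross_step s t -> double_cover s -> double_cover t.
Proof.
move=> [X [Y [r [/and3P[XY0 _ _] ps pt]]]] [s0 s2]; split.
  move: s0; rewrite (perm_mem ps) (perm_mem pt) !inE !negb_or eq_sym.
  move=> /and3P[X0 _ ->]; rewrite eq_sym XY0 eq_sym setU_eq0.
  by rewrite negb_and X0.
move=> v; rewrite -(s2 v) (permP ps) (permP pt) /= !inE.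
by case: (v \in X); case: (v \in Y).
Qed.

(** If [Z] lies in both [X] and [Y], it lies in both replacements; if in only one of them, it still
    lies in the union. *)
Lemma uncross_step_count_subset Z s t : uncross_step s t ->
  count (fun X => Z \subset X) s <= count (fun X => Z \subset X) t.
Proof.
move=> [X [Y [r [_ ps pt]]]]; rewrite (permP ps) (permP pt) /= subsetI.
have := @subset_trans _ Z X (X :|: Y); have := @subset_trans _ Z Y (X :|: Y).
rewrite subsetUl subsetUr.
case: (Z \subset X) => [_|HY _]; first by move=> /(_ isT isT) ->; lia.
by case: (Z \subset Y) HY => [/(_ isT isT) ->|_] /=; lia.
Qed.

Lemma uncross_step_enlarge s t X : uncross_step s t -> X \in s ->
  exists2 Y, Y \in t & X \subset Y.
Proof.
move=> [A [B [r [_ ps pt]]]]; rewrite (perm_mem ps) !inE.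
case/or3P=> [/eqP->|/eqP->|Xr].
- by exists (A :|: B); rewrite ?subsetUl // (perm_mem pt) !inE eqxx orbT.
- by exists (A :|: B); rewrite ?subsetUr // (perm_mem pt) !inE eqxx orbT.
- by exists X; rewrite // (perm_mem pt) !inE Xr !orbT.
Qed.

Local Notation uncross := (clos_refl_trans_1n _ (@uncross_step V)).

Lemma uncross_double_cover s t : uncross s t -> double_cover s -> double_cover t.
Proof.
elim=> // x y z xy _ IH xc; apply: IH; exact: uncross_step_double_cover xy xc.
Qed.

Lemma uncross_count_subset Z s t : uncross s t ->
  count (fun X => Z \subset X) s <= count (fun X => Z \subset X) t.
Proof.
elim=> // x y z xy _ IH; exact: leq_trans (uncross_step_count_subset Z xy) IH.
Qed.

Lemma uncross_enlarge s t X : uncross s t -> X \in s ->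
  exists2 Y, Y \in t & X \subset Y.
Proof.
move=> st; elim: st X => [x X xX|x y z xy _ IH X xX]; first by exists X.
have [Y yY XY] := uncross_step_enlarge xy xX.
by have [W zW YW] := IH _ yY; exists W => //; apply: subset_trans YW.
Qed.

(** Termination by concavity: a step keeps the sum of the two sizes but spreads them apart, so the
    sum of [#|X| * (#|V| - #|X|)] strictly drops. *)
Lemma uncrossing_exists s : exists t, uncross s t /\ uncrossed t.
Proof.
have [n] := ubnP (\sum_(X <- s) #|X| * (#|V| - #|X|)).
elim: n s => // n IH s lesn.
case: (boolP (has (fun X => has (properly_intersecting X) s) s)); last first.
  move/hasPn=> sN; exists s; split; first exact: rt1n_refl.
  by move=> X Y Xs Ys; move/hasPn: (sN X Xs); apply.
move=> /hasP[X Xs /hasP[Y Ys XY]].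
have YX : Y != X.
  by apply: contraTneq XY => ->; rewrite /properly_intersecting setDv eqxx !andbF.
pose r := rem Y (rem X s).
have ps : perm_eq s [:: X, Y & r].
  apply: perm_trans (perm_to_rem Xs) _; rewrite perm_cons; apply: perm_to_rem.
  by move: Ys; rewrite (perm_mem (perm_to_rem Xs)) inE (negPf YX).
have step : uncross_step s [:: X :&: Y, X :|: Y & r] by exists X, Y, r.
have [|t [st tU]] := IH [:: X :&: Y, X :|: Y & r]; last first.
  by exists t; split=> //; apply: rt1n_trans st.
apply: leq_trans _ (ltnSE lesn); rewrite (perm_big _ ps) /= !big_cons !addnA ltn_add2r.
have /and3P[_] := XY; rewrite -!card_gt0 => XDY YDX.
have := cardsUI X Y; have := cardsID Y X; have := cardsID X Y.
rewrite [Y :&: X]setIC.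
have := max_card (X :|: Y); move: XDY YDX.
move: #|X :\: Y| #|Y :\: X| #|X :&: Y| #|X :|: Y| #|X| #|Y| #|V|.
move=> b c a u x y m b0 c0 um ey ex eu.
have {}ex : x = a + b by lia.
have {}ey : y = a + c by lia.
have {}eu : u = a + b + c by lia.
(* With [d] points outside the union, the potential drops by exactly [2 * b * c], where [b] and [c]
   are the positive sizes of the two differences. *)
have [d ->] : exists d, m = u + d by exists (m - u); lia.
subst.
have -> : a + b + c + d - a = b + c + d by lia.
have -> : a + b + c + d - (a + b + c) = d by lia.
have -> : a + b + c + d - (a + b) = c + d by lia.
have -> : a + b + c + d - (a + c) = b + d by lia.
nia.
Qed.

Lemma partition_double_cover P1 P2 :
  partition P1 [set: V] -> partition P2 [set: V] ->
  double_cover (enum P1 ++ enum P2).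
Proof.
have cover1 P v : partition P [set: V] -> count (fun X => v \in X) (enum P) = 1.
  move=> /and3P[/eqP covP tiP _].
  have vP : v \in cover P by rewrite covP inE.
  rewrite -size_filter -(@perm_size _ [:: pblock P v]) //.
  apply: uniq_perm => [||X] //; first exact: filter_uniq (enum_uniq _).
  rewrite mem_filter mem_enum inE; apply/eqP/andP=> [->|[vX XP]].
    by rewrite mem_pblock vP pblock_mem.
  by rewrite (def_pblock tiP XP vX).
move=> P1p P2p; split; last by move=> v; rewrite count_cat !cover1.
by rewrite mem_cat !mem_enum; case/and3P: P1p => _ _ /negPf->; case/and3P: P2p.
Qed.

(** * Minimal and maximal members of an uncrossed double cover *)

Section Outcome.
Variable t : seq {set V}.
Hypotheses (tc : double_cover t) (tU : uncrossed t).

Let nested X Y v : X \in t -> Y \in t -> v \in X -> v \in Y ->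
  (X \subset Y) || (Y \subset X).
Proof.
move=> Xt Yt vX vY; have := tU Xt Yt.
rewrite /properly_intersecting !negb_and !negbK !setD_eq0.
by case/or3P=> [/eqP/setP/(_ v)|->|->]; rewrite ?orbT // !inE vX vY.
Qed.

(** Two members containing [Z] share a point, hence are nested. The smaller one is minimal, since a
    member properly inside it would cover some point a third time. *)
Lemma minimal_member_above Z : Z != set0 ->
  1 < count (fun X => Z \subset X) t ->
  exists2 X, X \in minimal_members t & Z \subset X.
Proof.
case/set0Pn=> z zZ /count_gt1_perm [X [Y [r [pt ZX ZY]]]].
wlog XY : X Y pt ZX ZY / X \subset Y => [wlogXY|].
  have Xt : X \in t by rewrite (perm_mem pt) !inE eqxx.
  have Yt : Y \in t by rewrite (perm_mem pt) !inE eqxx orbT.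
  have /orP[XY|YX] := nested Xt Yt (subsetP ZX _ zZ) (subsetP ZY _ zZ).
    exact: wlogXY XY.
  apply: wlogXY YX => //; apply: perm_trans pt _.
  by have /permPl -> := perm_catCA [:: X] [:: Y] r.
exists X; rewrite // inE (perm_mem pt) !inE eqxx /=.
apply/allP=> W Wt; apply/negP=> WX.
have /set0Pn[w wW] : W != set0 by apply: contraNneq tc.1 => <-.
have wX := subsetP (proper_sub WX) w wW.
have := tc.2 w; rewrite (permP pt) /= wX (subsetP XY _ wX) /=.
move: Wt; rewrite (perm_mem pt) !inE => /or3P[/eqP WeX|/eqP WeY|Wr].
- by rewrite WeX properxx in WX.
- by rewrite WeY properE XY andbF in WX.
- have : has (fun X0 => w \in X0) r by apply/hasP; exists W.
  by rewrite has_count; lia.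
Qed.

Lemma maximal_member_above X : X \in t ->
  exists2 Y, Y \in maximal_members t & X \subset Y.
Proof.
move=> Xt; have [|Y /maxsetP[/andP[Yt XY] Ymax] _] :=
  @maxset_exists _ [pred Y : {set V} | (Y \in t) && (X \subset Y)] X.
  by rewrite inE Xt subxx.
exists Y => //; rewrite inE Yt; apply/allP=> W Wt; apply/negP=> /andP[YW].
by rewrite (Ymax W) ?subxx //= Wt (subset_trans XY).
Qed.

(** Members sharing a point are nested, so in an antichain they are equal; this gives
    disjointness. *)
Let antichain_partition P : {subset P <= t} ->
  {in P &, forall X Y, ~~ (X \proper Y)} -> (forall v, v \in cover P) ->
  partition P [set: V].
Proof.
move=> Pt antiP covP; apply/and3P; split.
- by apply/eqP/setP=> v; rewrite inE covP.
- apply/trivIsetP=> X Y XP YP; apply: contraR.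
  case/pred0Pn=> v /andP[/= vX vY].
  have := nested (Pt _ XP) (Pt _ YP) vX vY.
  have := antiP _ _ XP YP; have := antiP _ _ YP XP.
  rewrite eqEsubset !properE.
  by case: (X \subset Y); case: (Y \subset X).
- by apply: contra tc.1; apply: Pt.
Qed.

Lemma minimal_members_partition : partition (minimal_members t) [set: V].
Proof.
apply: antichain_partition => [X|X Y|v]; first by rewrite inE => /andP[].
  by rewrite !inE => /andP[Xt _] /andP[_ /allP]; apply.
(* The singleton of [v] lies in two members because [v] is covered twice. *)
have [|| X Xm] := @minimal_member_above [set v].
- by apply/set0Pn; exists v; rewrite inE.
- by under eq_count => X do rewrite sub1set; rewrite tc.2.
by rewrite sub1set => vX; apply/bigcupP; exists X.
Qed.

Lemma maximal_members_partition : partition (maximal_members t) [set: V].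
Proof.
apply: antichain_partition => [X|X Y|v]; first by rewrite inE => /andP[].
  by rewrite !inE => /andP[_ /allP Xm] /andP[Yt _]; apply: Xm.
have /hasP[X Xt vX] : has (fun X => v \in X) t by rewrite has_count tc.2.
have [Y Ym XY] := maximal_member_above Xt.
by apply/bigcupP; exists Y => //; apply: subsetP XY _ vX.
Qed.

(** One member containing [Z] extends to a maximal one, a second one yields a minimal one, and a
    point of [Z] rules out a third. *)
Lemma count_subset_outcome Z : Z != set0 ->
  count (fun X => Z \subset X) t <=
    ~~ crosses Z (minimal_members t) + ~~ crosses Z (maximal_members t).
Proof.
move=> Z0; have [z zZ] := set0Pn _ Z0.
have le2 : count (fun X => Z \subset X) t <= 2.
  rewrite -(tc.2 z); apply: sub_count => X /= /subsetP; exact.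
have [->//|c0] := posnP (count (fun X => Z \subset X) t).
have -> : ~~ crosses Z (maximal_members t).
  move: c0; rewrite -has_count => /hasP[X Xt ZX].
  have [Y Ym XY] := maximal_member_above Xt.
  by apply/crossesPn; exists Y => //; apply: subset_trans XY.
case: ltnP (minimal_member_above Z0) => [_ /(_ isT) [X Xm ZX]|]; last by lia.
by have -> : ~~ crosses Z (minimal_members t) by apply/crossesPn; exists X.
Qed.

End Outcome.

(** * Submodularity of crossing for a single hyperedge *)

Section Crossing.
Variables (P1 P2 : {set {set V}}) (t : seq {set V}).
Hypotheses (P1p : partition P1 [set: V]) (P2p : partition P2 [set: V]).
Hypothesis tP : uncrossing_outcome P1 P2 t.

Let tc : double_cover t.
Proof. exact: uncross_double_cover tP.1 (partition_double_cover P1p P2p). Qed.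

(** Count members containing [Z]: each partition that [Z] does not cross supplies one, uncrossing
    never lowers the count, and the outcome has at most as many as there are partitions among the
    final two that [Z] does not cross. *)
Lemma crosses_submodular Z : Z != set0 ->
  crosses Z (minimal_members t) + crosses Z (maximal_members t) <=
    crosses Z P1 + crosses Z P2.
Proof.
move=> Z0; have := count_subset_outcome tc tP.2 Z0.
have := uncross_count_subset Z tP.1; rewrite count_cat.
have count_enum P : ~~ crosses Z P <= count (fun X => Z \subset X) (enum P).
  case: (boolP (crosses Z P)) => // /crossesPn[X XP ZX].
  by rewrite -has_count; apply/hasP; exists X; rewrite // mem_enum.
have := count_enum P1; have := count_enum P2; lia.
Qed.

(** Uncrossing only enlarges classes upwards, so [X] and [Y] lie in maximal members; these share a
    point of [X :&: Y] and therefore coincide. *)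
Lemma not_crosses_join Z X Y : X \in P1 -> Y \in P2 -> X :&: Y != set0 ->
  Z \subset X :|: Y -> ~~ crosses Z (maximal_members t).
Proof.
move=> XP YP /set0Pn[w]; rewrite inE => /andP[wX wY] ZXY.
have above U : U \in enum P1 ++ enum P2 ->
    exists2 W, W \in maximal_members t & U \subset W.
  case/(uncross_enlarge tP.1)=> W /maximal_member_above[W' W'm WW'] UW.
  by exists W' => //; apply: subset_trans WW'.
have [|A Am XA] := above X; first by rewrite mem_cat mem_enum XP.
have [|B Bm YB] := above Y; first by rewrite mem_cat !mem_enum YP orbT.
have /and3P[_ tiM _] := maximal_members_partition tc tP.2.
have AB : A = B.
  rewrite -(def_pblock tiM Am (subsetP XA _ wX)).
  by rewrite (def_pblock tiM Bm (subsetP YB _ wY)).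
apply/crossesPn; exists A => //; apply: subset_trans ZXY _.
by rewrite subUset XA AB YB.
Qed.

End Crossing.

(** * Blocked vertices and vertex removal *)

Variable I : finType.
Implicit Types H G : I -> {set V}.

Lemma crossing_countE H P : crossing_count H P = \sum_i crosses (H i) P.
Proof. by rewrite /crossing_count cardsE -sum1_card big_mkcond. Qed.

Definition blocked (p : {set {set V}} -> int) H i v : bool :=
  [exists P : {set {set V}}, [&& partition P [set: V], p P == crossing_count H P,
     crosses (H i) P & ~~ crosses (H i :\ v) P]].

Lemma blocked_unique (p : {set {set V}} -> int) H i u v :
  partition_supermodular p -> is_hypergraph H ->
  (forall P, partition P [set: V] -> (p P <= crossing_count H P)%R) ->
  2 < #|H i| -> u \in H i -> v \in H i ->
  blocked p H i u -> blocked p H i v -> u = v.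
Proof.
move=> pS hH pH H3 uH vH /existsP[P1 /and4P[P1p /eqP p1 cP1 /crossesPn[X XP HX]]].
move=> /existsP[P2 /and4P[P2p /eqP p2 cP2 /crossesPn[Y YP HY]]].
apply/eqP/negPn/negP=> uv.
have [t tP] := uncrossing_exists (enum P1 ++ enum P2).
have tc := uncross_double_cover tP.1 (partition_double_cover P1p P2p).
have := pS _ _ _ P1p P2p tP; rewrite p1 p2.
have := pH _ (minimal_members_partition tc tP.2).
have := pH _ (maximal_members_partition tc tP.2).
(* Both partitions are tight, so supermodularity and the covering of the meet and join give the
   reverse inequality; a strict one is a contradiction. *)
suff : crossing_count H (minimal_members t) + crossing_count H (maximal_members t)
    < crossing_count H P1 + crossing_count H P2 by lia.
rewrite !crossing_countE -!big_split /= (bigD1 i) //= [ltnRHS](bigD1 i) //=.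
have H0 j : H j != set0 by rewrite -card_gt0; apply: leq_trans (hH j).
(* The strictness is charged to hyperedge [i]; the others need only submodularity. *)
rewrite -addSn leq_add //; last by apply: leq_sum => j _; apply: crosses_submodular.
(* [X] misses at most [u] and [Y] at most [v], so they cover [H i] together, and a third vertex of
   [H i] lies in both. *)
have /negPf-> : ~~ crosses (H i) (maximal_members t).
  apply: (not_crosses_join P1p P2p tP XP YP).
    have /set0Pn[w] : H i :\ u :\ v != set0.
      rewrite -card_gt0; have := cardsD1 u (H i); have := cardsD1 v (H i :\ u).
      by rewrite !inE uH vH; lia.
    rewrite !inE => /and3P[wv wu wH]; apply/set0Pn; exists w.
    by rewrite inE (subsetP HX) ?(subsetP HY) // !inE ?wv ?wu.
  apply/subsetP=> w wH; rewrite inE.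
  have [wu|wu] := eqVneq w u; last by rewrite (subsetP HX) // !inE wu.
  by rewrite (subsetP HY) ?orbT // !inE wH wu uv.
by rewrite cP1 cP2; case: (crosses (H i) _).
Qed.

Definition remove_vertex H i v : I -> {set V} :=
  fun j => if j == i then H i :\ v else H j.

(** Removal lowers the count of [P] by at most one, and only if [H i] crosses [P] while [H i :\ v]
    does not. Then [P] is not tight, and integrality leaves a slack of at least one. *)
Lemma remove_vertex_covers (p : {set {set V}} -> int) H i v :
  (forall P, partition P [set: V] -> (p P <= crossing_count H P)%R) ->
  ~~ blocked p H i v ->
  forall P, partition P [set: V] ->
    (p P <= crossing_count (remove_vertex H i v) P)%R.
Proof.
move=> pH /existsPn nb P Pp.
have : crossing_count (remove_vertex H i v) P + crosses (H i) P
    = crossing_count H P + crosses (H i :\ v) P.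
  rewrite !crossing_countE (bigD1 i) //= [in RHS](bigD1 i) //=.
  rewrite /remove_vertex eqxx addnC [RHS]addnAC -addnA; congr (_ + (_ + _)).
  by apply: eq_bigr => j /negPf->.
have := pH P Pp; have := nb P; rewrite Pp /=.
by case: (crosses (H i) P); case: (crosses (H i :\ v) P); lia.
Qed.

Lemma crossing_count_subset H G P : (forall i, G i \subset H i) ->
  crossing_count G P <= crossing_count H P.
Proof.
move=> GH; rewrite !crossing_countE; apply: leq_sum => i _.
case: (boolP (crosses (H i) P)) => [|/crossesPn[X XP HX]]; first by rewrite leq_b1.
have /negPf-> // : ~~ crosses (G i) P.
by apply/crossesPn; exists X => //; apply: subset_trans HX.
Qed.

Lemma removable_vertex (p1 p2 : {set {set V}} -> int) H i :
  partition_supermodular p1 -> partition_supermodular p2 -> is_hypergraph H ->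
  covers_on_partitions H p1 p2 -> 2 < #|H i| ->
  exists2 v, v \in H i & covers_on_partitions (remove_vertex H i v) p1 p2.
Proof.
move=> S1 S2 hH cH H3.
have c1 P : partition P [set: V] -> (p1 P <= crossing_count H P)%R.
  by move=> /cH; rewrite ge_max => /andP[].
have c2 P : partition P [set: V] -> (p2 P <= crossing_count H P)%R.
  by move=> /cH; rewrite ge_max => /andP[].
have card_blocked p : partition_supermodular p ->
    (forall P, partition P [set: V] -> (p P <= crossing_count H P)%R) ->
    #|[set v in H i | blocked p H i v]| <= 1.
  move=> S c; apply/card_le1_eqP=> u v; rewrite !inE => /andP[uH bu] /andP[vH bv].
  exact: blocked_unique bv bu.
have : ~~ (H i \subset [set v in H i | blocked p1 H i v] :|:
                       [set v in H i | blocked p2 H i v]).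
  apply/negP=> /subset_leq_card.
  have := cardsUI [set v in H i | blocked p1 H i v] [set v in H i | blocked p2 H i v].
  have := card_blocked _ S1 c1; have := card_blocked _ S2 c2; lia.
case/subsetPn=> v vH; rewrite !inE vH /= negb_or => /andP[b1 b2].
exists v => // P Pp; rewrite ge_max.
by rewrite !remove_vertex_covers.
Qed.

End Uncrossing.

Theorem theorem2 (V I : finType) (p1 p2 : {set {set V}} -> int)
    (H : I -> {set V})
    (hp1 : partition_supermodular p1) (hp2 : partition_supermodular p2)
    (hH : is_hypergraph H) :
  (exists G : I -> {set V}, is_trimming H G /\ covers_on_partitions G p1 p2)
  <-> covers_on_partitions H p1 p2.
Proof.
split=> [[G [[_ GH] cG]] P Pp|].
  by apply: le_trans (cG P Pp) _; rewrite lez_nat crossing_count_subset.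
(* Induction on the total size of the hyperedges; once none has more than two vertices, [H] is a
   trimming of itself. *)
have [n] := ubnP (\sum_i #|H i|); elim: n H hH => // n IH H hH lesn cH.
case: (boolP [exists i, 2 < #|H i|]) => [/existsP[i H3]|/existsPn H2]; last first.
  exists H; split=> //; split=> // i; apply/eqP.
  by rewrite eqn_leq hH andbT leqNgt H2.
have [v vH cH'] := removable_vertex hp1 hp2 hH cH H3.
have sub j : remove_vertex H i v j \subset H j.
  by rewrite /remove_vertex; case: eqP => // ->; rewrite subD1set.
have cardD := cardsD1 v (H i); rewrite vH in cardD.
have [|| //|G [[G2 GH] cG]] := IH (remove_vertex H i v).
- by move=> j; rewrite /remove_vertex; case: eqP => _ //; lia.
- apply: leq_trans _ (ltnSE lesn); rewrite (bigD1 i) //= [ltnRHS](bigD1 i) //=.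
  rewrite -addSn leq_add ?leq_sum // => [|j _]; last by rewrite subset_leq_card.
  by rewrite /remove_vertex eqxx cardD.
exists G; split=> //; split=> // j; exact: subset_trans (GH j) (sub j).
Qed.
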